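(* The set of all degree-2 induced faithful representations ${}_{(a,b,s)}\rho_2:\mathcal{S}_3\hookrightarrow\mathcal{R}_2(\mathbb{Z}_3)$ consists of exactly two nonequivalent representations. That is, for each $a\in\{1,2\}$, ${}_{(a,b,s)}\rho_2={}_{(a,b',s')}\rho_2$ for all $b,b'\in\mathbb{Z}_3$ and $s,s'\in\{1,2\}$, and ${}_{(1,b,s)}\rho_2$ is not equivalent to ${}_{(2,b,s)}\rho_2$.
   Context: $\mathbb{Z}_3$ is the field of integers modulo $3$. The Riordan group $\mathcal{R}(\mathbb{Z}_3)$ is the set of pairs $(g(t),f(t))$ of formal power series over $\mathbb{Z}_3$ with $g(0)\neq0$, $f(0)=0$, $f'(0)\neq 0$, with operation $(g_1,f_1)*(g_2,f_2)=(g_1(t)g_2(f_1(t)),\,f_2(f_1(t)))$; the pair $(g,f)$ is identified with the infinite lower triangular matrix $(a_{n,k})_{n,k\ge0}$, $a_{n,k}=[t^n]g(t)f(t)^k$, the operation being matrix multiplication. Taking the first two rows and columns gives a group epimorphism $\pi_2:\mathcal{R}(\mathbb{Z}_3)\to\mathcal{R}_2(\mathbb{Z}_3)$ onto the truncated Riordan group $$\mathcal{R}_2(\mathbb{Z}_3)=\left\{\begin{pmatrix}a&0\\ b&c\end{pmatrix}: a,b,c\in\mathbb{Z}_3,\ a,c\neq0\right\}\subset \mathrm{GL}(2,\mathbb{Z}_3).$$ $\mathcal{S}_3\cong\langle\sigma_1,\sigma_2\mid\sigma_1^2=\sigma_2^2=(\sigma_1\sigma_2)^3=1\rangle$ is the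 symmetric group of degree 3, with $\sigma_1=(1\,2)$, $\sigma_2=(1\,3)$. For $a\in\{1,2\}$, $b\in\mathbb{Z}_3$, $s\in\{1,2\}$, put $$r_1=\left(\frac{a}{(1+(b+1)t)^s},\frac{2t}{1+(b+1)t}\right),\qquad r_2=\left(\frac{a}{(1+bt)^s},\frac{2t}{1+bt}\right)\in\mathcal{R}(\mathbb{Z}_3).$$ These are involutions generating a subgroup isomorphic to $\mathcal{S}_3$. Let ${}_{(a,b,s)}\rho:\mathcal{S}_3\to\mathcal{R}(\mathbb{Z}_3)$ be the corresponding faithful representation, with $\sigma_1\mapsto r_2$, $\sigma_2\mapsto r_1$, and let ${}_{(a,b,s)}\rho_2=\pi_2\circ{}_{(a,b,s)}\rho$, the induced representation of degree 2. Two representations $\varphi,\psi:G\to\mathrm{GL}(2,\mathbb{Z}_3)$ are equivalent if there is $T\in\mathrm{GL}(2,\mathbb{Z}_3)$ with $\varphi(g)=T\psi(g)T^{-1}$ for all $g\in G$.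
   Formalization: The equality of the representations (a,b,s) and (a,b',s') is proved as equivalence of representations; literal equality fails, e.g. for a=1, s=s'=1, b=0, b'=1 the images of σ_1 differ in the lower-left entry. *)

(* Defs.v *)
From HB Require Import structures.
From mathcomp Require Import all_boot all_order all_fingroup all_algebra.
From mathcomp Require Import mxrepresentation.
From mathcomp Require Import boolp.
From mathcomp Require Import ring.

Set Implicit Arguments.
Unset Strict Implicit.
Unset Printing Implicit Defensive.

Import GRing.Theory.
Local Open Scope ring_scope.

(* Formal power series over a field, as coefficient sequences: for f : fps F, *)
(* the coefficient [t^n] f is written f n.                                    *)
Record fps (F : fieldType) := Fps { fps_coef :> nat -> F }.
Arguments Fps {F}.

Section Solver.
Variable F : fieldType.

(* Forward substitution: solve A u is the solution x of the infinite lower    *)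
(* triangular system \sum_(k <= n) A n k * x k = u n, when no A n n is 0.     *)
Fixpoint solve_seq (A : nat -> nat -> F) (u : nat -> F) (n : nat) : seq F :=
  if n is m.+1 then
    let x := solve_seq A u m in
    rcons x ((A m m)^-1 * (u m - \sum_(k < m) A m k * x`_k))
  else [::].

Definition solve A u n := (solve_seq A u n.+1)`_n.

Lemma size_solve_seq A u n : size (solve_seq A u n) = n.
Proof. by elim: n => //= n IHn; rewrite size_rcons IHn. Qed.

Lemma nth_solve_seq A u n k : (k < n)%N -> (solve_seq A u n)`_k = solve A u k.
Proof.
elim: n => // n IHn; rewrite ltnS leq_eqVlt => /predU1P[-> // | ltkn] /=.
by rewrite nth_rcons size_solve_seq ltkn IHn.
Qed.

Lemma solveP A u (A_neq0 : forall n, A n n != 0) n :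
  \sum_(k < n.+1) A n k * solve A u k = u n.
Proof.
rewrite big_ord_recr /= {2}/solve /= nth_rcons size_solve_seq ltnn eqxx.
rewrite mulVKf //.
under [X in _ + (_ - X)]eq_bigr => k _ do rewrite nth_solve_seq //.
by rewrite addrC subrK.
Qed.

End Solver.

Section FpsRing.
Variable F : fieldType.
Implicit Types (f g h : fps F) (p q : {poly F}).

Lemma fpsP f g : f =1 g -> f = g.
Proof. by case: f g => [f] [g] /= /funext->. Qed.

HB.instance Definition _ := gen_eqMixin (fps F).
HB.instance Definition _ := gen_choiceMixin (fps F).

Definition fps0 : fps F := Fps (fun=> 0).
Definition fps_opp f : fps F := Fps (fun n => - f n).
Definition fps_add f g : fps F := Fps (fun n => f n + g n).
Definition fps1 : fps F := Fps (fun n => (n == 0%N)%:R).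
Definition fps_mul f g : fps F :=
  Fps (fun n => \sum_(i < n.+1) f i * g (n - i)%N).

Fact fps_addA : associative fps_add.
Proof. by move=> f g h; apply: fpsP => n /=; rewrite addrA. Qed.
Fact fps_addC : commutative fps_add.
Proof. by move=> f g; apply: fpsP => n /=; rewrite addrC. Qed.
Fact fps_add0 : left_id fps0 fps_add.
Proof. by move=> f; apply: fpsP => n /=; rewrite add0r. Qed.
Fact fps_addN : left_inverse fps0 fps_opp fps_add.
Proof. by move=> f; apply: fpsP => n /=; rewrite addNr. Qed.

HB.instance Definition _ :=
  GRing.isZmodule.Build (fps F) fps_addA fps_addC fps_add0 fps_addN.

Definition agree n f p := forall i, (i <= n)%N -> f i = p`_i.

Lemma agreeP f g :
  (forall n, exists2 p, agree n f p & agree n g p) -> f = g.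
Proof. by move=> fg; apply: fpsP => n; case: (fg n) => p -> // ->. Qed.

Lemma agree_ex n f : exists p, agree n f p.
Proof.
by exists (\poly_(i < n.+1) f i) => i le_in; rewrite coef_poly ltnS le_in.
Qed.

Lemma agree1 n : agree n fps1 1.
Proof. by move=> i _; rewrite coef1. Qed.

Lemma agreeD n f g p q :
  agree n f p -> agree n g q -> agree n (fps_add f g) (p + q).
Proof. by move=> fp gq i le_in; rewrite coefD /= fp ?gq. Qed.

Lemma agreeM n f g p q :
  agree n f p -> agree n g q -> agree n (fps_mul f g) (p * q).
Proof.
move=> fp gq i le_in; rewrite coefM /=; apply: eq_bigr => j _.
by rewrite fp ?gq // ?(leq_trans (leq_subr _ _)) // (leq_trans _ le_in) // -ltnS.
Qed.

Fact fps_mulA : associative fps_mul.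
Proof.
move=> f g h; apply: agreeP => n.
case: (agree_ex n f) (agree_ex n g) (agree_ex n h) => p fp [q gq] [r hr].
by exists (p * (q * r)); [|rewrite mulrA]; do !apply: agreeM.
Qed.
Fact fps_mulC : commutative fps_mul.
Proof.
move=> f g; apply: agreeP => n.
case: (agree_ex n f) (agree_ex n g) => p fp [q gq].
by exists (p * q); [|rewrite mulrC]; apply: agreeM.
Qed.
Fact fps_mul1 : left_id fps1 fps_mul.
Proof.
move=> f; apply: agreeP => n; case: (agree_ex n f) => p fp.
by exists p => //; rewrite -[p]mul1r; apply: agreeM => //; apply: agree1.
Qed.
Fact fps_mulDl : left_distributive fps_mul fps_add.
Proof.
move=> f g h; apply: agreeP => n.
case: (agree_ex n f) (agree_ex n g) (agree_ex n h) => p fp [q gq] [r hr].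
exists ((p + q) * r); first by apply: agreeM => //; apply: agreeD.
by rewrite mulrDl; apply: agreeD; apply: agreeM.
Qed.
Fact fps1_neq0 : fps1 != fps0.
Proof.
apply/eqP => /(congr1 (fun f : fps F => f 0%N)) /= /eqP.
by rewrite oner_eq0.
Qed.

HB.instance Definition _ := GRing.Zmodule_isComNzRing.Build (fps F)
  fps_mulA fps_mulC fps_mul1 fps_mulDl fps1_neq0.

Lemma fps_coef0 n : (0 : fps F) n = 0. Proof. by []. Qed.
Lemma fps_coef1 n : (1 : fps F) n = (n == 0%N)%:R. Proof. by []. Qed.
Lemma fps_coefD f g n : (f + g) n = f n + g n. Proof. by []. Qed.
Lemma fps_coefN f n : (- f) n = - f n. Proof. by []. Qed.
Lemma fps_coefM f g n : (f * g) n = \sum_(i < n.+1) f i * g (n - i)%N.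
Proof. by []. Qed.

Lemma fps_coefM0 f g : (f * g) 0%N = f 0%N * g 0%N.
Proof. by rewrite fps_coefM big_ord1. Qed.

Lemma fps_coefX0 f n : (f ^+ n) 0%N = f 0%N ^+ n.
Proof. by elim: n => // n IHn; rewrite !exprS fps_coefM0 IHn. Qed.

Lemma agreeX n f p k : agree n f p -> agree n (f ^+ k) (p ^+ k).
Proof.
move=> fp; elim: k => [|k IHk]; first exact: agree1.
by rewrite !exprS; apply: agreeM.
Qed.

Definition fps_unit : {pred fps F} := fun f => f 0%N != 0.
Definition fps_inv f : fps F :=
  if f 0%N != 0 then Fps (solve (fun n k => f (n - k)%N) (1 : fps F)) else f.

Fact fps_mulV : {in fps_unit, left_inverse 1 fps_inv *%R}.
Proof.
move=> f; rewrite unfold_in /fps_inv => f0; rewrite f0 mulrC; apply: fpsP => n.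
rewrite mulrC fps_coefM /= -[RHS](@solveP F (fun n k => f (n - k)%N) (1 : fps F)).
  by apply: eq_bigr => k _; rewrite mulrC.
by move=> m; rewrite subnn.
Qed.
Fact fps_unitPl f g : g * f = 1 -> fps_unit f.
Proof.
move=> /(congr1 (fun f : fps F => f 0%N)); rewrite fps_coefM0 => gf.
by apply/eqP => f0; move/eqP: gf; rewrite f0 mulr0 eq_sym oner_eq0.
Qed.
Fact fps_inv_out : {in [predC fps_unit], fps_inv =1 id}.
Proof. by move=> f; rewrite inE unfold_in /fps_inv => /negPf->. Qed.

HB.instance Definition _ := GRing.ComNzRing_hasMulInverse.Build (fps F)
  fps_mulV fps_unitPl fps_inv_out.

Lemma fps_unitE f : (f \is a GRing.unit) = (f 0%N != 0).
Proof. by []. Qed.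

Lemma fps_coefV0 f : f 0%N != 0 -> (f^-1) 0%N = (f 0%N)^-1.
Proof.
move=> f0; apply: (mulIf f0); rewrite mulVf // -fps_coefM0 mulVr //.
Qed.

End FpsRing.

Definition fpsC {F : fieldType} (a : F) : fps F :=
  Fps (fun n => if n is 0%N then a else 0).
Definition fpsX {F : fieldType} : fps F := Fps (fun n => (n == 1%N)%:R).

(* The substitution f(h(t)), meaningful only if h(0) = 0. Then h ^+ k has no  *)
(* term of degree less than k, so truncating the sum at k <= n is harmless.   *)
Definition fps_comp {F : fieldType} (f h : fps F) : fps F :=
  Fps (fun n => \sum_(k < n.+1) f k * (h ^+ k) n).

Section FpsComp.
Variable F : fieldType.
Implicit Types (f g h : fps F) (p q : {poly F}).

Lemma agreeC n (a : F) : agree n (fpsC a) a%:P.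
Proof. by case=> [|i] _; rewrite coefC. Qed.
Lemma agreeX1 n : agree n (@fpsX F) 'X.
Proof. by move=> i _; rewrite coefX. Qed.

Lemma fpsCX_eq0 h k n : h 0%N = 0 -> (n < k)%N -> (h ^+ k) n = 0.
Proof.
move=> h0; elim: k n => // k IHk n lt_nk; rewrite exprS fps_coefM big1 // => i _.
case: i => [[|i] lti] /=; first by rewrite h0 mul0r.
by rewrite IHk ?mulr0 //; case: n lt_nk lti => // n ? _; rewrite subSS;
  exact: leq_ltn_trans (leq_subr _ _) _.
Qed.

Lemma coef_expX_diag h k : h 0%N = 0 -> (h ^+ k) k = h 1%N ^+ k.
Proof.
move=> h0; elim: k => // k IHk; rewrite !exprS fps_coefM.
rewrite 2!big_ord_recl h0 mul0r add0r /= /bump /= add1n subn1 /= IHk.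
rewrite big1 ?addr0 // => i _.
rewrite fpsCX_eq0 ?mulr0 // /bump /= !add1n subSS.
by case: k IHk i => [|k] _ [i lti] //=; rewrite subSS ltnS leq_subr.
Qed.

Lemma agree_comp n f h p q : h 0%N = 0 ->
  agree n f p -> agree n h q -> agree n (fps_comp f h) (p \Po q).
Proof.
move=> h0 fp hq i le_in; rewrite coef_comp_poly /=.
have q0 k : (i < k)%N -> (q ^+ k)`_i = 0.
  by move=> lt_ik; rewrite -(agreeX k hq) // fpsCX_eq0.
pose G k := p`_k * (q ^+ k)`_i.
rewrite -[RHS](big_mkord xpredT G).
transitivity (\sum_(0 <= k < i.+1) G k).
  rewrite big_mkord; apply: eq_bigr => k _; rewrite /G -(agreeX k hq) // fp //.
  by rewrite (leq_trans _ le_in) // -ltnS.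
have [le_pi|lt_ip] := leqP (size p) i.+1.
  rewrite [LHS](big_cat_nat _ le_pi) //= [X in _ + X = _]big_nat_cond.
  rewrite [X in _ + X = _]big1 ?addr0 // => k /andP[/andP[lepk _] _].
  by rewrite /G nth_default ?mul0r.
rewrite [RHS](big_cat_nat _ (ltnW lt_ip)) //= [X in _ = _ + X]big_nat_cond.
by rewrite [X in _ = _ + X]big1 ?addr0 // => k /andP[/andP[lt_ik _] _]; rewrite /G q0 ?mulr0.
Qed.

Lemma comp_fps0 f h : (fps_comp f h) 0%N = f 0%N.
Proof. by rewrite /= big_ord1 expr0 mulr1. Qed.

Lemma comp_fps1 f h : (fps_comp f h) 1%N = f 1%N * h 1%N.
Proof. by rewrite /= 2!big_ord_recr big_ord0 /= mulr0 !add0r. Qed.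

Lemma comp_fpsM f g h : h 0%N = 0 ->
  fps_comp (f * g) h = fps_comp f h * fps_comp g h.
Proof.
move=> h0; apply: agreeP => n.
case: (agree_ex n f) (agree_ex n g) (agree_ex n h) => p fp [q gq] [r hr].
exists ((p * q) \Po r); first by apply: agree_comp => //; apply: agreeM.
by rewrite comp_polyM; apply: agreeM; apply: agree_comp.
Qed.

Lemma comp_fpsD f g h : fps_comp (f + g) h = fps_comp f h + fps_comp g h.
Proof.
apply: fpsP => n; rewrite fps_coefD /= -big_split; apply: eq_bigr => k _.
by rewrite mulrDl.
Qed.

Lemma comp_fpsC a h : fps_comp (fpsC a) h = fpsC a.
Proof.
apply: fpsP => n /=; rewrite big_ord_recl big1 ?addr0 => [|k _].
  by rewrite expr0; case: n => [|n]; rewrite ?mulr1 ?mulr0.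
by rewrite mul0r.
Qed.

Lemma fpsC1 : fpsC 1 = 1 :> fps F.
Proof. by apply: fpsP; case. Qed.
Lemma fpsC0 : fpsC 0 = 0 :> fps F.
Proof. by apply: fpsP; case. Qed.
Lemma fpsCD a b : fpsC (a + b) = fpsC a + fpsC b :> fps F.
Proof. by apply: fpsP; case => [//|n]; rewrite fps_coefD /= addr0. Qed.
Lemma fps_coefCM a f n : (fpsC a * f) n = a * f n.
Proof.
by rewrite fps_coefM big_ord_recl big1 ?addr0 /= ?subn0 // => i _; rewrite mul0r.
Qed.
Lemma fpsCM a b : fpsC (a * b) = fpsC a * fpsC b :> fps F.
Proof.
by apply: fpsP => n; rewrite fps_coefCM; case: n => //= n; rewrite mulr0.
Qed.

Lemma comp_fps_1 h : fps_comp 1 h = 1.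
Proof. by rewrite -fpsC1 comp_fpsC. Qed.

Lemma comp_fpsX f h k : h 0%N = 0 ->
  fps_comp (f ^+ k) h = fps_comp f h ^+ k.
Proof.
move=> h0; elim: k => [|k IHk]; first exact: comp_fps_1.
by rewrite !exprS comp_fpsM // IHk.
Qed.

Lemma comp_fpsV f h : h 0%N = 0 -> f 0%N != 0 ->
  fps_comp f^-1 h = (fps_comp f h)^-1.
Proof.
move=> h0 f0; have uf : fps_comp f h \is a GRing.unit.
  by rewrite fps_unitE comp_fps0.
by apply: (mulIr uf); rewrite mulVr // -comp_fpsM // mulVr // comp_fps_1.
Qed.

Lemma comp_Xfps h : h 0%N = 0 -> fps_comp fpsX h = h.
Proof.
move=> h0; apply: agreeP => n; case: (agree_ex n h) => r hr.
by exists r => //; rewrite -[r]comp_polyX; apply: agree_comp => //; apply: agreeX1.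
Qed.

Lemma comp_fps_X f : fps_comp f fpsX = f.
Proof.
apply: agreeP => n; case: (agree_ex n f) => r fr.
by exists r => //; rewrite -[r]comp_polyXr; apply: agree_comp => //; apply: agreeX1.
Qed.

Lemma comp_fpsA f g h : g 0%N = 0 -> h 0%N = 0 ->
  fps_comp f (fps_comp g h) = fps_comp (fps_comp f g) h.
Proof.
move=> g0 h0; apply: agreeP => n.
case: (agree_ex n f) (agree_ex n g) (agree_ex n h) => p fp [q gq] [r hr].
exists (p \Po (q \Po r)).
  by do !apply: agree_comp => //; rewrite comp_fps0.
by rewrite comp_polyA; do !apply: agree_comp.
Qed.

Lemma mul_fps_comp g u h n : h 0%N = 0 ->
  (g * fps_comp u h) n = \sum_(j < n.+1) u j * (g * h ^+ j) n.
Proof.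
move=> h0; rewrite fps_coefM /=.
transitivity (\sum_(i < n.+1) \sum_(k < n.+1) g i * (u k * (h ^+ k) (n - i)%N)).
  apply: eq_bigr => i _; rewrite mulr_sumr.
  have le_i : ((n - i).+1 <= n.+1)%N by rewrite ltnS leq_subr.
  rewrite -(big_mkord xpredT (fun k => g i * (u k * (h ^+ k) (n - i)%N))).
  rewrite -(big_mkord xpredT (fun k => g i * (u k * (h ^+ k) (n - i)%N))).
  rewrite [RHS](big_cat_nat _ le_i) //= [X in _ = _ + X]big_nat_cond.
  rewrite [X in _ = _ + X]big1 ?addr0 // => k /andP[/andP[ltk _] _].
  by rewrite fpsCX_eq0 ?mulr0.
rewrite exchange_big; apply: eq_bigr => j _.
by rewrite /= mulr_sumr; apply: eq_bigr => i _; rewrite mulrCA.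
Qed.

(* The solution x of x(h(t)) = u(t), when h(0) = 0 and h'(0) != 0.            *)
Definition fps_solve_comp h (u : fps F) : fps F :=
  Fps (solve (fun n k => (h ^+ k) n) u).

Lemma fps_solve_compP h u : h 0%N = 0 -> h 1%N != 0 ->
  fps_comp (fps_solve_comp h u) h = u.
Proof.
move=> h0 h1; apply: fpsP => n /=.
rewrite -[RHS](@solveP F (fun n k => (h ^+ k) n) u) => [|m].
  by apply: eq_bigr => k _; rewrite mulrC.
by rewrite coef_expX_diag // expf_neq0.
Qed.

End FpsComp.

(* Here rd_f 1 is the coefficient of t, i.e. f'(0).                           *)
Record riordan (F : fieldType) := Riordan {
  rd_g : fps F;
  rd_f : fps F;
  rd_g0 : rd_g 0%N != 0;
  rd_f0 : rd_f 0%N == 0;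
  rd_f1 : rd_f 1%N != 0 }.

Section RiordanGroup.
Variable F : fieldType.
Implicit Types A B C : riordan F.

Lemma riordanP A B : rd_g A = rd_g B -> rd_f A = rd_f B -> A = B.
Proof.
case: A B => [g f g0 f0 f1] [g' f' g0' f0' f1'] /= eq_g eq_f; subst g' f'.
by congr Riordan; apply: bool_irrelevance.
Qed.

HB.instance Definition _ := gen_eqMixin (riordan F).
HB.instance Definition _ := gen_choiceMixin (riordan F).

Fact riordan_one_subproof : (1 : fps F) 0%N != 0.
Proof. by rewrite fps_coef1 oner_neq0. Qed.
Definition riordan_one : riordan F :=
  @Riordan F 1 fpsX riordan_one_subproof (eqxx _) (oner_neq0 F).

Fact riordan_mul_g0 A B : (rd_g A * fps_comp (rd_g B) (rd_f A)) 0%N != 0.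
Proof. by rewrite fps_coefM0 comp_fps0 mulf_neq0 ?rd_g0. Qed.
Fact riordan_mul_f0 A B : (fps_comp (rd_f B) (rd_f A)) 0%N == 0.
Proof. by rewrite comp_fps0 rd_f0. Qed.
Fact riordan_mul_f1 A B : (fps_comp (rd_f B) (rd_f A)) 1%N != 0.
Proof. by rewrite comp_fps1 mulf_neq0 ?rd_f1. Qed.
Definition riordan_mul A B : riordan F :=
  Riordan (riordan_mul_g0 A B) (riordan_mul_f0 A B) (riordan_mul_f1 A B).

Definition riordan_inv_g A := fps_solve_comp (rd_f A) (rd_g A)^-1.
Definition riordan_inv_f A := fps_solve_comp (rd_f A) fpsX.
Fact riordan_inv_gP A : fps_comp (riordan_inv_g A) (rd_f A) = (rd_g A)^-1.
Proof. by rewrite fps_solve_compP ?rd_f1 // (eqP (rd_f0 A)). Qed.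
Fact riordan_inv_fP A : fps_comp (riordan_inv_f A) (rd_f A) = fpsX.
Proof. by rewrite fps_solve_compP ?rd_f1 // (eqP (rd_f0 A)). Qed.
Fact riordan_inv_g0 A : (riordan_inv_g A) 0%N != 0.
Proof.
by rewrite -(comp_fps0 _ (rd_f A)) riordan_inv_gP fps_coefV0 ?invr_eq0 rd_g0.
Qed.
Fact riordan_inv_f0 A : (riordan_inv_f A) 0%N == 0.
Proof. by rewrite -(comp_fps0 _ (rd_f A)) riordan_inv_fP. Qed.
Fact riordan_inv_f1 A : (riordan_inv_f A) 1%N != 0.
Proof.
have := comp_fps1 (riordan_inv_f A) (rd_f A); rewrite riordan_inv_fP /=.
by move=> eq1; apply/eqP => h1; move/eqP: eq1; rewrite h1 mul0r oner_eq0.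
Qed.
Definition riordan_inv A : riordan F :=
  Riordan (riordan_inv_g0 A) (riordan_inv_f0 A) (riordan_inv_f1 A).

Fact riordan_mulA : associative riordan_mul.
Proof.
move=> A B C; have fA0 := eqP (rd_f0 A); have fB0 := eqP (rd_f0 B).
apply: riordanP => /=; last by rewrite comp_fpsA.
by rewrite comp_fpsM // mulrA comp_fpsA.
Qed.
Fact riordan_mul1 : left_id riordan_one riordan_mul.
Proof. by move=> A; apply: riordanP; rewrite /= comp_fps_X ?mul1r. Qed.
Fact riordan_mulr1 : right_id riordan_one riordan_mul.
Proof.
move=> A; apply: riordanP => /=; first by rewrite comp_fps_1 mulr1.
by rewrite comp_Xfps // (eqP (rd_f0 A)).
Qed.
Fact riordan_mulrV : right_inverse riordan_one riordan_inv riordan_mul.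
Proof.
move=> A; apply: riordanP => /=; last exact: riordan_inv_fP.
by rewrite riordan_inv_gP mulrV // fps_unitE rd_g0.
Qed.
Fact riordan_mulV : left_inverse riordan_one riordan_inv riordan_mul.
Proof.
move=> A; set B := riordan_inv A; rewrite -[LHS]riordan_mulr1.
rewrite -{1}(riordan_mulrV B) -riordan_mulA [riordan_mul A _]riordan_mulA.
by rewrite riordan_mulrV riordan_mul1 riordan_mulrV.
Qed.

HB.instance Definition _ := isGroup.Build (riordan F)
  riordan_mulA riordan_mul1 riordan_mulr1 riordan_mulV riordan_mulrV.

Lemma rd_gM A B : rd_g (A * B)%g = rd_g A * fps_comp (rd_g B) (rd_f A).
Proof. by []. Qed.
Lemma rd_fM A B : rd_f (A * B)%g = fps_comp (rd_f B) (rd_f A).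
Proof. by []. Qed.

Definition riordan_entry A (n k : nat) : F := (rd_g A * rd_f A ^+ k) n.

Definition riordan_trunc (N : nat) A : 'M[F]_N :=
  \matrix_(i < N, j < N) riordan_entry A i j.

Lemma riordan_entry_lower A n k : (n < k)%N -> riordan_entry A n k = 0.
Proof.
move=> lt_nk; rewrite /riordan_entry fps_coefM big1 // => i _.
by rewrite fpsCX_eq0 ?mulr0 ?(eqP (rd_f0 A)) // (leq_ltn_trans (leq_subr _ _)).
Qed.

Lemma riordan_entryM A B n k : riordan_entry (A * B)%g n k =
  \sum_(j < n.+1) riordan_entry A n j * riordan_entry B j k.
Proof.
have fA0 := eqP (rd_f0 A).
rewrite {1}/riordan_entry rd_gM rd_fM -mulrA -comp_fpsX // -comp_fpsM //.
by rewrite mul_fps_comp //; apply: eq_bigr => j _; rewrite mulrC.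
Qed.

Lemma riordan_truncM N A B :
  riordan_trunc N (A * B)%g = riordan_trunc N A *m riordan_trunc N B.
Proof.
apply/matrixP => i k; rewrite !mxE riordan_entryM.
rewrite -(big_mkord xpredT (fun j => riordan_entry A i j * riordan_entry B j k)).
under eq_bigr => j _ do rewrite /=.
transitivity (\sum_(0 <= j < N) riordan_entry A i j * riordan_entry B j k).
  rewrite [RHS](big_cat_nat _ (ltn_ord i)) //= [X in _ = _ + X]big_nat_cond.
  rewrite [X in _ = _ + X]big1 ?addr0 // => j /andP[/andP[lt_ij _] _].
  by rewrite riordan_entry_lower ?mul0r.
by rewrite big_mkord; apply: eq_bigr => j _; rewrite !mxE.
Qed.

Lemma riordan_trunc1 N : riordan_trunc N 1%g = 1%:M.
Proof.
apply/matrixP => i j; rewrite !mxE /riordan_entry.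
rewrite (_ : rd_g 1%g = 1) // (_ : rd_f 1%g = fpsX) // mul1r.
have ->: forall k n, ((@fpsX F) ^+ k) n = (n == k)%:R => //.
elim=> [|k IHk] n; first by [].
rewrite exprS fps_coefM; case: n => [|n]; first by rewrite big_ord1 mul0r.
rewrite 2!big_ord_recl /= mul0r add0r mul1r /bump /= add1n subn1 IHk.
by rewrite big1 ?addr0 // => l _; rewrite /= mul0r.
Qed.

End RiordanGroup.

Section LinearFractional.
Variable F : fieldType.
Implicit Types (a b c : F) (s : nat).

Definition lin_g a b s : fps F := fpsC a / (1 + fpsC b * fpsX) ^+ s.
Definition lin_f c b : fps F := fpsC c * fpsX / (1 + fpsC b * fpsX).

Lemma lin_den0 b : (1 + fpsC b * fpsX : fps F) 0%N = 1.
Proof. by rewrite fps_coefD fps_coefM0 fps_coef1 /= mulr0 addr0. Qed.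
Lemma lin_den_unit b : (1 + fpsC b * fpsX : fps F) \is a GRing.unit.
Proof. by rewrite fps_unitE lin_den0 oner_neq0. Qed.

Lemma lin_gE0 a b s : lin_g a b s 0%N = a.
Proof.
rewrite /lin_g fps_coefM0 fps_coefV0 fps_coefX0 lin_den0 expr1n ?oner_neq0 //.
by rewrite invr1 mulr1.
Qed.
Lemma lin_fE0 c b : lin_f c b 0%N = 0.
Proof. by rewrite /lin_f !fps_coefM0 /= mulr0 mul0r. Qed.
Lemma lin_fE1 c b : lin_f c b 1%N = c.
Proof.
rewrite /lin_f -mulrA fps_coefM 2!big_ord_recl big_ord0 /= mul0r !addr0.
rewrite 2!big_ord_recl big_ord0 /= mul0r add0r mul1r addr0 subnn.
by rewrite fps_coefV0 lin_den0 ?oner_neq0 // invr1 mulr1.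
Qed.

Fact lin_riordan_g0 a b s : a != 0 -> lin_g a b s 0%N != 0.
Proof. by rewrite lin_gE0. Qed.
Fact lin_riordan_f0 c b : lin_f c b 0%N == 0.
Proof. by rewrite lin_fE0. Qed.
Fact lin_riordan_f1 c b : c != 0 -> lin_f c b 1%N != 0.
Proof. by rewrite lin_fE1. Qed.

Definition lin_riordan a c (a0 : a != 0) (c0 : c != 0) b s : riordan F :=
  Riordan (lin_riordan_g0 b s a0) (lin_riordan_f0 c b) (lin_riordan_f1 b c0).

Lemma lin_riordanM a c a' c' (a0 : a != 0) (c0 : c != 0) (a0' : a' != 0)
    (c0' : c' != 0) b b' s :
  (lin_riordan a0 c0 b s * lin_riordan a0' c0' b' s)%g =
  lin_riordan (mulf_neq0 a0 a0') (mulf_neq0 c0 c0') (b + c * b') s.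
Proof.
have L0 := lin_fE0 c b.
have uu := lin_den_unit b; have uv := lin_den_unit (b + c * b').
have den : fps_comp (1 + fpsC b' * fpsX) (lin_f c b) =
    (1 + fpsC (b + c * b') * fpsX) / (1 + fpsC b * fpsX).
  rewrite comp_fpsD comp_fpsM // comp_fps_1 comp_fpsC comp_Xfps // /lin_f.
  apply: (mulIr uu); rewrite mulrDl mulrVK // mul1r mulrA mulrVK //.
  by rewrite fpsCD fpsCM; ring.
apply: riordanP; rewrite ?rd_gM ?rd_fM /=.
  rewrite {2}/lin_g comp_fpsM // comp_fpsV ?fps_coefX0 ?lin_den0 ?expr1n ?oner_neq0 //.
  rewrite comp_fpsX // den comp_fpsC /lin_g exprMn exprVn.
  rewrite invrM ?unitrV ?unitrX // invrK fpsCM mulrACA.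
  by rewrite mulKr // unitrX.
rewrite {1}/lin_f !comp_fpsM // comp_fpsV ?lin_den0 ?oner_neq0 // den comp_Xfps //.
rewrite comp_fpsC invrM ?unitrV // invrK /lin_f fpsCM -!mulrA mulKr //.
by rewrite !mulrA [fpsC c' * _]mulrC.
Qed.

Lemma lin_riordan_eq a c a' c' (a0 : a != 0) (c0 : c != 0) (a0' : a' != 0)
    (c0' : c' != 0) b b' s : a = a' -> c = c' -> b = b' ->
  lin_riordan a0 c0 b s = lin_riordan a0' c0' b' s.
Proof. by move=> ea ec eb; apply: riordanP; rewrite /= ?ea ?ec ?eb. Qed.

Lemma lin_riordan1 (a0 c0 : (1 : F) != 0) s : lin_riordan a0 c0 0 s = 1%g.
Proof.
by apply: riordanP; rewrite /= /lin_g /lin_f fpsC0 fpsC1 mul0r addr0 ?expr1n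
  invr1 !mulr1 ?mul1r.
Qed.

End LinearFractional.

Section DihedralWords.
Local Open Scope group_scope.
Variables (G : groupType) (x y : G).
Hypotheses (x2 : x * x = 1) (y2 : y * y = 1) (xy3 : (x * y) ^+ 3 = 1).
Let C := x * y.

Lemma dih_expC i j : i = j %[mod 3] -> C ^+ i = C ^+ j.
Proof.
have modC k : C ^+ k = C ^+ (k %% 3).
  by rewrite {1}(divn_eq k 3) expgnDr mulnC expgnA xy3 expg1n mul1g.
by move=> ij; rewrite modC ij -modC.
Qed.

Lemma dih_xC : x * C = C ^+ 2 * x.
Proof.
have xV : x^-1 = x by apply/esym/(mulIg x); rewrite mulVg.
have yV : y^-1 = y by apply/esym/(mulIg y); rewrite mulVg.
have CV : C ^+ 2 = C^-1 by apply: (mulIg C); rewrite -expgSr mulVg.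
by rewrite CV /C mulgA x2 mul1g invgM xV yV -mulgA x2 mulg1.
Qed.

Lemma dih_xCj j : x * C ^+ j = C ^+ (2 * j) * x.
Proof.
elim: j => [|j IHj]; first by rewrite muln0 mulg1 mul1g.
by rewrite expgSr mulgA IHj -mulgA dih_xC mulgA -expgnDr mulnS addnC.
Qed.

Lemma dih_mul i j (e f : bool) : (C ^+ i * x ^+ e) * (C ^+ j * x ^+ f) =
  C ^+ (i + (if e then 2 * j else j))%N * x ^+ (e (+) f).
Proof.
case: e; last by rewrite mulg1 mulgA -expgnDr.
rewrite expg1 -mulgA [x * _]mulgA dih_xCj mulgA mulgA -expgnDr -mulgA.
by case: f; rewrite /= ?expg1 ?x2 ?mulg1.
Qed.

End DihedralWords.

(* The transpositions (1 2) and (1 3) of S_3, here acting on 0, 1, 2 instead  *)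
(* of 1, 2, 3.                                                                *)
Definition sigma1 : 'S_3 := tperm 0 1.
Definition sigma2 : 'S_3 := tperm 0 2%:R.

Section S3Words.
Local Open Scope group_scope.
Let c := sigma1 * sigma2.

Lemma sigma12E i : c i = (i + 1)%R.
Proof.
rewrite permM /sigma1 /sigma2 !permE /=.
by case: i => [[|[|[|]]] // ?]; apply/val_inj.
Qed.

Lemma sigma12X k : (c ^+ k) 0%R = k%:R%R.
Proof.
elim: k => [|k IHk]; first by rewrite perm1.
by rewrite expgSr permM IHk sigma12E -natr1.
Qed.

Lemma sigma1_inv : sigma1 * sigma1 = 1. Proof. exact: tperm2. Qed.
Lemma sigma2_inv : sigma2 * sigma2 = 1. Proof. exact: tperm2. Qed.
Lemma sigma12_ord : c ^+ 3 = 1.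
Proof.
apply/permP => i; rewrite perm1 !expgS expg0 mulg1 (permM c) (permM c).
by rewrite !sigma12E; case: i => [[|[|[|]]] // ?]; apply/val_inj.
Qed.

Lemma odd_S3_word k (e : bool) : (c ^+ k * sigma1 ^+ e : bool) = e.
Proof.
rewrite odd_permM; have -> : (c ^+ k : bool) = false.
  elim: k => [|k IHk]; first exact: odd_perm1.
  by rewrite expgSr odd_permM IHk odd_permM !odd_tperm.
by case: e; rewrite ?odd_perm1 // odd_tperm.
Qed.

Lemma S3_word_inj k l (e f : bool) :
  c ^+ k * sigma1 ^+ e = c ^+ l * sigma1 ^+ f -> k = l %[mod 3] /\ e = f.
Proof.
move=> eq_kl; have eq_ef : e = f.
  by rewrite -(odd_S3_word k e) eq_kl odd_S3_word.
split=> //; move: eq_kl; rewrite eq_ef => /mulIg /permP /(_ 0%R).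
rewrite !sigma12X => eq_kl.
by rewrite -!(@val_Zp_nat 3) //; congr (nat_of_ord _).
Qed.

Lemma S3_word_onto (p : 'S_3) :
  exists w : 'I_3 * bool, p = c ^+ w.1 * sigma1 ^+ w.2.
Proof.
pose h (w : 'I_3 * bool) := c ^+ w.1 * sigma1 ^+ w.2.
have h_inj : injective h.
  move=> [i e] [j f] /S3_word_inj /= [ij ->]; congr (_, _); apply/val_inj.
  by rewrite /= -(modn_small (ltn_ord i)) ij modn_small.
have : p \in codom h.
  apply: inj_card_onto => //.
  by rewrite card_prod card_ord card_bool card_Sn.
by case/codomP => w ->; exists w.
Qed.

Lemma S3_hom (G : groupType) (x y : G) :
    x * x = 1 -> y * y = 1 -> (x * y) ^+ 3 = 1 ->
  exists phi : 'S_3 -> G,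
    [/\ {morph phi : p q / p * q}, phi sigma1 = x, phi sigma2 = y &
        forall k (e : bool),
          phi (c ^+ k * sigma1 ^+ e) = (x * y) ^+ k * x ^+ e].
Proof.
move=> x2 y2 xy3; have [w wP] := choice S3_word_onto.
pose phi p := (x * y) ^+ (w p).1 * x ^+ (w p).2.
have phiE k (e : bool) : phi (c ^+ k * sigma1 ^+ e) = (x * y) ^+ k * x ^+ e.
  have [/esym eq_k eq_e] := S3_word_inj (wP (c ^+ k * sigma1 ^+ e)).
  by rewrite /phi -eq_e (dih_expC xy3 eq_k).
exists phi; split=> //.
- move=> p q; rewrite {1}(wP p) {1}(wP q).
  rewrite (dih_mul sigma1_inv sigma2_inv sigma12_ord) phiE.
  by rewrite /phi (dih_mul x2 y2 xy3).
- by have := phiE 0%N true; rewrite !expg0 !mul1g.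
have := phiE 2 true; rewrite -(dih_xC sigma1_inv sigma2_inv sigma12_ord).
by rewrite -(dih_xC x2 y2 xy3) /c !mulgA sigma1_inv x2 !mul1g.
Qed.

End S3Words.

Fact F3_2_neq0 : (2%:R : 'F_3) != 0. Proof. by []. Qed.

Section Representations.
Variables (a : 'F_3) (a0 : a != 0) (b : 'F_3) (s : nat).

Definition r1 : riordan 'F_3 := lin_riordan a0 F3_2_neq0 (b + 1) s.
Definition r2 : riordan 'F_3 := lin_riordan a0 F3_2_neq0 b s.

Lemma F3_sqr : a * a = 1.
Proof. by case: a a0 => [[|[|[|]]] // ?] _; apply/val_inj. Qed.

Lemma r1_inv : (r1 * r1 = 1)%g.
Proof.
rewrite /r1 lin_riordanM -(lin_riordan1 (oner_neq0 _) (oner_neq0 _) s).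
apply: lin_riordan_eq; rewrite ?F3_sqr //; first exact/val_inj.
by case: b => [[|[|[|]]] // ?]; apply/val_inj.
Qed.

Lemma r2_inv : (r2 * r2 = 1)%g.
Proof.
rewrite /r2 lin_riordanM -(lin_riordan1 (oner_neq0 _) (oner_neq0 _) s).
apply: lin_riordan_eq; rewrite ?F3_sqr //; first exact/val_inj.
by case: b => [[|[|[|]]] // ?]; apply/val_inj.
Qed.

Lemma r21E :
  (r2 * r1)%g = lin_riordan (oner_neq0 'F_3) (oner_neq0 'F_3) 2%:R s.
Proof.
rewrite /r1 /r2 lin_riordanM; apply: lin_riordan_eq; rewrite ?F3_sqr //.
  exact/val_inj.
by case: b => [[|[|[|]]] // ?]; apply/val_inj.
Qed.

Lemma r21_ord : ((r2 * r1) ^+ 3 = 1)%g.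
Proof.
rewrite r21E !expgS expg0 mulg1 !lin_riordanM.
rewrite -(lin_riordan1 (oner_neq0 _) (oner_neq0 _) s).
by apply: lin_riordan_eq; apply/val_inj.
Qed.

Lemma rho_exists : exists phi : 'S_3 -> riordan 'F_3,
  [/\ {morph phi : p q / (p * q)%g}, injective phi,
      phi sigma1 = r2 & phi sigma2 = r1].
Proof.
have [phi [phiM phi1 phi2 phiE]] := S3_hom r2_inv r1_inv r21_ord.
exists phi; split=> // p q eq_pq.
have phi_one : phi 1%g = 1%g.
  by apply: (mulgI (phi 1%g)); rewrite -phiM !mulg1.
have phi_ker u : phi u = 1%g -> u = 1%g.
  have [[i e] -> /=] := S3_word_onto u; rewrite phiE r21E /= => phi_u1.
  have lin1 k : rd_f (lin_riordan (oner_neq0 'F_3) (oner_neq0 'F_3) 2%:R s ^+ k)%g 1%N = 1.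
    elim: k => [|k IHk]; first by [].
    by rewrite expgS rd_fM comp_fps1 IHk lin_fE1 mulr1.
  case: e phi_u1 => [/(congr1 (fun A : riordan 'F_3 => rd_f A 1%N))|].
    by rewrite expg1 rd_fM comp_fps1 lin1 lin_fE1 mulr1 => /(congr1 val).
  rewrite mulg1 => Ci; suff -> : (i : nat) = 0%N by rewrite expg0 mul1g.
  have C3 := r21_ord; rewrite r21E in C3.
  suff CN1 : lin_riordan (oner_neq0 'F_3) (oner_neq0 'F_3) 2%:R s <> 1%g.
    case: i Ci => [[|[|[|]]] //= _] Ci.
    by case: CN1; move: C3; rewrite expgS Ci mulg1.
  move=> /(congr1 (@rd_f _)) /= eq_f.
  have eqX : fpsX + fpsC 2%:R * fpsX ^+ 2 = fpsX :> fps 'F_3.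
    have := mulrVK (lin_den_unit (2%:R : 'F_3)) (fpsC 1 * fpsX).
    by rewrite -/(lin_f 1 2%:R) eq_f fpsC1 mul1r => eqX; rewrite -[RHS]eqX; ring.
  move/(congr1 (fun f : fps 'F_3 => f 2%N)): eqX.
  by rewrite fps_coefD fps_coefCM coef_expX_diag // => /(congr1 val).
apply/(mulIg (q^-1)%g); rewrite mulgV; apply: phi_ker.
by rewrite phiM eq_pq -phiM mulgV.
Qed.

(* As sigma1 and sigma2 generate S_3, this is the only such morphism.         *)
Definition rho : 'S_3 -> riordan 'F_3 := sval (cid rho_exists).

Lemma rhoP : [/\ {morph rho : p q / (p * q)%g}, injective rho,
  rho sigma1 = r2 & rho sigma2 = r1].
Proof. exact: svalP (cid rho_exists). Qed.

Fact rho2_subproof :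
  mx_repr [set: 'S_3] (fun p => riordan_trunc 2 (rho p)).
Proof.
have [rhoM _ _ _] := rhoP; split=> [|p q _ _]; last first.
  by rewrite rhoM riordan_truncM.
rewrite -(riordan_trunc1 'F_3 2); congr riordan_trunc.
by apply: (mulgI (rho 1%g)); rewrite -rhoM !mulg1.
Qed.

Definition rho2 : mx_representation 'F_3 [set: 'S_3] 2 :=
  MxRepresentation rho2_subproof.

End Representations.

Arguments r1 a a0 b s : clear implicits.
Arguments r2 a a0 b s : clear implicits.
Arguments rho a a0 b s : clear implicits.
Arguments rho2 a a0 b s : clear implicits.

Lemma mx_rsimP (phi psi : mx_representation 'F_3 [set: 'S_3] 2) :
  mx_rsim phi psi <->
  exists2 T, T \in unitmx & forall p, phi p = T *m psi p *m invmx T.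
Proof.
split=> [[T _ freeT eqT]|[T uT eqT]].
  exists T => [|p]; first by rewrite -row_free_unit.
  by rewrite -eqT ?inE // mulmxK // -row_free_unit.
exists T => //; first by rewrite row_free_unit.
by move=> p _; rewrite eqT mulmxKV.
Qed.

Definition riordan2 : {set 'M['F_3]_2} :=
  [set M : 'M['F_3]_2 | [&& M 0 0 != 0, M 0 1 == 0 & M 1 1 != 0]].

Lemma riordan_trunc2_in (A : riordan 'F_3) : riordan_trunc 2 A \in riordan2.
Proof.
have e11 : riordan_entry A 1 1 = rd_g A 0%N * rd_f A 1%N.
  rewrite /riordan_entry expr1 fps_coefM 2!big_ord_recl big_ord0 /=.
  by rewrite (eqP (rd_f0 A)) mulr0 !addr0.
rewrite inE !mxE (@riordan_entry_lower _ A 0 1) // eqxx [riordan_entry A 1%R _]e11.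
by rewrite mulf_neq0 ?rd_g0 ?rd_f1 // /riordan_entry expr0 mulr1 rd_g0.
Qed.

Definition induced_rep (phi : mx_representation 'F_3 [set: 'S_3] 2) : Prop :=
  exists (a : 'F_3) (a0 : a != 0) (b : 'F_3) (s : nat),
    s \in [:: 1; 2]%N /\ phi = rho2 a a0 b s.

(* Main.v *)
Require Import Defs.
From HB Require Import structures.
From mathcomp Require Import all_boot all_order all_fingroup all_algebra.
From mathcomp Require Import mxrepresentation.
From mathcomp Require Import ring.

Set Implicit Arguments.
Unset Strict Implicit.
Unset Printing Implicit Defensive.

Import GRing.Theory.
Local Open Scope ring_scope.

(* The degree 2 representation sends sigma1 and sigma2 to the lower           *)
(* triangular matrices [[a, 0], [x, -a]] and [[a, 0], [y, -a]], where         *)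
(* x = -sba and y = x - sa are distinct. So sigma1 sigma2 is sent to a        *)
(* nontrivial unipotent matrix, which gives faithfulness, and a lower         *)
(* triangular intertwiner between two such pairs with the same a is obtained  *)
(* by solving a linear system. Conversely, the row line fixed by              *)
(* sigma1 sigma2 is spanned by (1, 0), on which sigma1 acts by a, so that a   *)
(* is an invariant.                                                           *)

(** Equality of the representations for a given a holds up to a change of basis: the entry x depends
    on the product s b, so the matrices themselves vary with b and s. Truncation to degree 2 reads
    only g(0), g'(0) and f'(0), which turns the images of the generators into the explicit matrices
    of [rho2_sigma]. What remains concerns pairs of lower triangular matrices with entries x != y:
    [lower2_faithful], [lower2_rsim] (same a, hence equivalent) and [lower2_rsim_eq] (equivalent,
    hence same a). The condition s in {1, 2} makes s invertible modulo 3, which gives x != y in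
    [sigma_entries_neq]. *)

Lemma mulmx2E (R : pzRingType) (A B : 'M[R]_2) i j :
  (A *m B) i j = A i 0 * B 0 j + A i 1 * B 1 j.
Proof.
rewrite mxE !big_ord_recl big_ord0 addr0; congr (A i _ * B _ j + A i _ * B _ j).
all: exact/val_inj.
Qed.

Section LowerTriangular.
Variable R : comNzRingType.
Implicit Types p u v : R.

Definition lower2 p u v : 'M[R]_2 :=
  \matrix_(i, j) if i == 0 then p *+ (j == 0) else if j == 0 then u else v.

Lemma lower2M p u v p' u' v' :
  lower2 p u v *m lower2 p' u' v' = lower2 (p * p') (u * p' + v * u') (v * v').
Proof.
apply/matrixP => i j; rewrite mulmx2E !mxE.
by case: i j => [[|[|i]] // ?] [[|[|j]] // ?] /=; ring.
Qed.

Lemma lower2_1 : 1%:M = lower2 1 0 1.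
Proof.
apply/matrixP => i j; rewrite !mxE.
by case: i j => [[|[|i]] // ?] [[|[|j]] // ?].
Qed.

Lemma lower2_inj p u v p' u' v' : lower2 p u v = lower2 p' u' v' ->
  [/\ p = p', u = u' & v = v'].
Proof.
move/matrixP=> eqM; have := eqM 0 0; have := eqM 1 0; have := eqM 1 1.
by rewrite !mxE.
Qed.

End LowerTriangular.

Lemma lower2_unit (F : fieldType) (p u v : F) :
  p != 0 -> v != 0 -> lower2 p u v \in unitmx.
Proof.
move=> p0 v0; suff /mulmx1_unit[] : lower2 p u v *m
    lower2 p^-1 (- v^-1 * u * p^-1) v^-1 = 1%:M by [].
by rewrite lower2M lower2_1; congr lower2; field; rewrite ?p0 ?v0.
Qed.

Lemma fps_coefM1 (F : fieldType) (f g : fps F) :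
  (f * g) 1%N = f 0%N * g 1%N + f 1%N * g 0%N.
Proof. by rewrite fps_coefM !big_ord_recl big_ord0 addr0. Qed.

Lemma lin_den_exp1 (F : fieldType) (b : F) s :
  ((1 + fpsC b * fpsX : fps F) ^+ s) 1%N = s%:R * b.
Proof.
elim: s => [|s IHs]; first by rewrite mul0r.
rewrite exprS fps_coefM1 IHs fps_coefX0 lin_den0 expr1n.
rewrite fps_coefD fps_coefCM fps_coef1 /= -natr1.
by ring.
Qed.

(** Multiplying g by (1 + bt)^s leaves the constant a, whose coefficient of t vanishes; the product
    rule then determines g'(0). *)
Lemma lin_gE1 (F : fieldType) (a b : F) s : lin_g a b s 1%N = - (s%:R * b * a).
Proof.
have : (lin_g a b s * (1 + fpsC b * fpsX) ^+ s) 1%N = 0.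
  by rewrite mulrVK // unitrX ?lin_den_unit.
rewrite fps_coefM1 lin_gE0 fps_coefX0 lin_den0 expr1n mulr1 lin_den_exp1.
by move=> eq0; apply/eqP; rewrite -addr_eq0 addrC mulrC eq0.
Qed.

Lemma riordan_trunc2E (F : fieldType) (A : riordan F) :
  riordan_trunc 2 A =
  lower2 (rd_g A 0%N) (rd_g A 1%N) (rd_g A 0%N * rd_f A 1%N).
Proof.
apply/matrixP => i j; rewrite !mxE.
case: i j => [[|[|i]] // ?] [[|[|j]] // ?] //=.
- by rewrite /riordan_entry expr0 mulr1.
- by rewrite riordan_entry_lower.
- by rewrite /riordan_entry expr0 mulr1.
by rewrite /riordan_entry expr1 fps_coefM1 (eqP (rd_f0 A)) mulr0 addr0.
Qed.

Lemma trunc_lin_riordan2 (a : 'F_3) (a0 : a != 0) b s :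
  riordan_trunc 2 (lin_riordan a0 F3_2_neq0 b s) =
  lower2 a (- (s%:R * b * a)) (- a).
Proof.
rewrite riordan_trunc2E -[rd_g _]/(lin_g a b s) -[rd_f _]/(lin_f 2%:R b).
rewrite lin_gE0 lin_gE1 lin_fE1; congr lower2.
(* In characteristic 3, f'(0) = 2 is -1. *)
by rewrite (_ : 2%:R = -1) ?mulrN1 //; apply/val_inj.
Qed.

Lemma rho2_sigma (a : 'F_3) (a0 : a != 0) b s :
  rho2 a a0 b s sigma1 = lower2 a (- (s%:R * b * a)) (- a) /\
  rho2 a a0 b s sigma2 = lower2 a (- (s%:R * (b + 1) * a)) (- a).
Proof.
by have [_ _ e1 e2] := rhoP a0 b s; rewrite /= e1 e2 !trunc_lin_riordan2.
Qed.

Lemma F3_natr_neq0 s : s \in [:: 1; 2]%N -> s%:R != 0 :> 'F_3.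
Proof. by rewrite !inE => /orP[] /eqP->. Qed.

Local Notation rep2 := (mx_representation 'F_3 [set: 'S_3] 2).

Lemma S3_rep_word (phi : rep2) k (e : bool) :
  phi ((sigma1 * sigma2) ^+ k * sigma1 ^+ e)%g =
  (phi sigma1 *m phi sigma2) ^+ k *m (phi sigma1) ^+ e.
Proof.
have inT (p : 'S_3) : p \in [set: 'S_3] by rewrite in_setT.
rewrite [LHS](repr_mxM phi (inT _) (inT _)) (repr_mxX phi k (inT _)).
rewrite (repr_mxX phi e (inT _)).
by rewrite (repr_mxM phi (inT _) (inT _)).
Qed.

(** Intertwining passes to products and powers, and every permutation is a word in [sigma1] and
    [sigma2]. *)
Lemma mx_rsim_sigma (phi psi : rep2) T : T \in unitmx ->
  phi sigma1 *m T = T *m psi sigma1 -> phi sigma2 *m T = T *m psi sigma2 ->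
  mx_rsim phi psi.
Proof.
move=> uT T1 T2; exists T => [//||p _]; first by rewrite row_free_unit.
have TM A B A' B' : A *m T = T *m A' -> B *m T = T *m B' ->
    A *m B *m T = T *m (A' *m B').
  by move=> eA eB; rewrite -mulmxA eB !mulmxA eA.
have TX k A A' : A *m T = T *m A' -> A ^+ k *m T = T *m A' ^+ k.
  move=> eA; elim: k => [|k IHk]; first by rewrite !expr0 mul1mx mulmx1.
  by rewrite !exprS; apply: TM.
have [w ->] := S3_word_onto p.
by rewrite !S3_rep_word; apply: (TM); apply: (TX) => //; apply: (TM).
Qed.

Lemma lower2_faithful (phi : rep2) (a x y : 'F_3) : a * a = 1 -> x != y ->
  phi sigma1 = lower2 a x (- a) -> phi sigma2 = lower2 a y (- a) ->
  mx_faithful phi.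
Proof.
move=> aa xy e1 e2; apply/subsetP => p /rkerP[_]; rewrite inE.
have [[k e] ->] := S3_word_onto p; rewrite S3_rep_word e1 e2 lower2M mulrNN aa.
have -> (z : 'F_3) n : lower2 1 z 1 ^+ n = lower2 1 (z *+ n) 1.
  elim: n => [|n IHn]; first by rewrite expr0 -lower2_1.
  by rewrite exprS IHn [_ * _]lower2M !mulr1 mul1r mulrS.
rewrite lower2_1; case: e => /=.
  (* An odd word has diagonal (a, -a), so being the identity would force 1 = -1. *)
  rewrite expr1 lower2M => /lower2_inj[]; rewrite !mul1r => -> _.
  by move/(congr1 val).
(* An even word has lower left entry (x - y) a k, and k < 3, so its vanishing forces k = 0. *)
rewrite expr0 mulmx1 => /lower2_inj[_ + _]; rewrite mulNr [a * y]mulrC.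
rewrite -mulrBl -mulr_natr => /eqP.
have a0 : a != 0.
  by apply: contra_eq_neq aa => ->; rewrite mul0r eq_sym oner_eq0.
rewrite !mulf_eq0 subr_eq0 (negPf xy) (negPf a0) /=.
by case: k => [[|[|[|]]] // ?]; rewrite /= expg0 mulg1.
Qed.

(** For T with rows (1, 0) and (u, v), intertwining amounts to 2 a u = x - v x' and 2 a u = y - v
    y'. Subtracting gives v = (x - y) / (x' - y'), which is nonzero, and then u. *)
Lemma lower2_rsim (phi psi : rep2) (a x y x' y' : 'F_3) :
    a != 0 -> x != y -> x' != y' ->
    phi sigma1 = lower2 a x (- a) -> phi sigma2 = lower2 a y (- a) ->
    psi sigma1 = lower2 a x' (- a) -> psi sigma2 = lower2 a y' (- a) ->
  mx_rsim phi psi.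
Proof.
move=> a0 xy xy' e1 e2 e1' e2'; pose v := (x - y) / (x' - y').
have v0 : v != 0 by rewrite mulf_neq0 ?invr_eq0 ?subr_eq0.
have d0 : x' - y' != 0 by rewrite subr_eq0.
have two0 : (2%:R : 'F_3) != 0 by [].
apply: (@mx_rsim_sigma _ _ (lower2 1 ((x - v * x') / (2%:R * a)) v)).
- by rewrite lower2_unit ?oner_neq0.
- by rewrite e1 e1' !lower2M; congr lower2; rewrite /v; field;
    rewrite ?a0 ?d0 ?two0.
by rewrite e2 e2' !lower2M; congr lower2; rewrite /v; field;
  rewrite ?a0 ?d0 ?two0.
Qed.

Lemma lower2_rsim_eq (phi psi : rep2) (a x y a' x' y' : 'F_3) : x' != y' ->
    phi sigma1 = lower2 a x (- a) -> phi sigma2 = lower2 a y (- a) ->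
    psi sigma1 = lower2 a' x' (- a') -> psi sigma2 = lower2 a' y' (- a') ->
  mx_rsim phi psi -> a = a'.
Proof.
move=> xy' e1 e2 e1' e2' [T _ freeT eqT].
have [] := (eqT sigma1 (in_setT _), eqT sigma2 (in_setT _)).
rewrite e1 e2 e1' e2' => eqT1 eqT2.
have row0 (z z' : 'F_3) : lower2 a z (- a) *m T = T *m lower2 a' z' (- a') ->
    a * T 0 0 = T 0 0 * a' + T 0 1 * z'.
  by move/matrixP/(_ 0 0); rewrite !mulmx2E !mxE /= mul0r addr0.
(* Both generators give the same equation on the first row of T except for the factors x' and y' of
   [T 0 1]; these differ, so [T 0 1] vanishes. *)
have T01 : T 0 1 = 0.
  have := row0 _ _ eqT1; rewrite (row0 _ _ eqT2) => /addrI/eqP.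
  rewrite -subr_eq0 -mulrBr mulf_eq0 subr_eq0 [y' == _]eq_sym (negPf xy') orbF.
  by move/eqP.
have := row0 _ _ eqT1; rewrite T01 mul0r addr0 mulrC; apply: mulfI.
(* If [T 0 0] vanished too, the first row of T would be zero. *)
apply: contraTneq freeT => T00; apply/row_freeP => -[B] /matrixP/(_ 0 0).
by rewrite mulmx2E T00 T01 !mul0r addr0 mxE.
Qed.

Lemma sigma_entries_neq (a : 'F_3) (a0 : a != 0) b s : s \in [:: 1; 2]%N ->
  - (s%:R * b * a) != - (s%:R * (b + 1) * a).
Proof.
move=> /F3_natr_neq0 s0; rewrite -subr_eq0.
rewrite (_ : _ - _ = s%:R * a); last by ring.
by rewrite mulf_neq0.
Qed.

(** The two proofs of [a != 0] are kept independent so that any induced representation can be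
    compared with a fixed representative. *)
Lemma rho2_rsim (a : 'F_3) (a0 a0' : a != 0) b b' s s' :
  s \in [:: 1; 2]%N -> s' \in [:: 1; 2]%N ->
  mx_rsim (rho2 a a0 b s) (rho2 a a0' b' s').
Proof.
move=> hs hs'; have [e1 e2] := rho2_sigma a0 b s.
have [e1' e2'] := rho2_sigma a0' b' s'.
by apply: lower2_rsim e1 e2 e1' e2'; rewrite ?sigma_entries_neq.
Qed.

Lemma rho2_rsim_eq (a a' : 'F_3) (a0 : a != 0) (a0' : a' != 0) b b' s s' :
  s' \in [:: 1; 2]%N -> mx_rsim (rho2 a a0 b s) (rho2 a' a0' b' s') -> a = a'.
Proof.
move=> hs'; have [e1 e2] := rho2_sigma a0 b s.
have [e1' e2'] := rho2_sigma a0' b' s'.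
by apply: lower2_rsim_eq e1 e2 e1' e2'; rewrite sigma_entries_neq.
Qed.

Theorem theorem9 :
  [/\ forall phi : mx_representation 'F_3 [set: 'S_3] 2, induced_rep phi ->
        mx_faithful phi /\ (forall p : 'S_3, phi p \in riordan2),
      exists phi psi : mx_representation 'F_3 [set: 'S_3] 2,
        [/\ induced_rep phi, induced_rep psi, ~ mx_rsim phi psi &
            forall chi : mx_representation 'F_3 [set: 'S_3] 2,
              induced_rep chi -> mx_rsim chi phi \/ mx_rsim chi psi],
      forall (a : 'F_3) (a0 : a != 0) (b b' : 'F_3) (s s' : nat),
        s \in [:: 1; 2]%N -> s' \in [:: 1; 2]%N ->
        mx_rsim (rho2 a a0 b s) (rho2 a a0 b' s') &
      forall (b : 'F_3) (s : nat), s \in [:: 1; 2]%N ->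
        ~ mx_rsim (rho2 1 (oner_neq0 'F_3) b s) (rho2 2%:R F3_2_neq0 b s)].
Proof.
have nsim (b : 'F_3) s : s \in [:: 1; 2]%N ->
    ~ mx_rsim (rho2 1 (oner_neq0 'F_3) b s) (rho2 2%:R F3_2_neq0 b s).
  by move=> hs /(rho2_rsim_eq hs) /(congr1 val).
split=> // [_ [a [a0 [b [s [hs ->]]]]]||a a0 b b' s s'].
- split=> [|p]; last exact: riordan_trunc2_in.
  have [e1 e2] := rho2_sigma a0 b s.
  exact: lower2_faithful (F3_sqr a0) (sigma_entries_neq a0 b hs) e1 e2.
(* The values b = 0 and s = 1 of the representatives are arbitrary; only a distinguishes the two
   classes. *)
- exists (rho2 1 (oner_neq0 'F_3) 0 1), (rho2 2%:R F3_2_neq0 0 1).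
  split; [by exists 1, (oner_neq0 'F_3), 0, 1%N |
          by exists 2%:R, F3_2_neq0, 0, 1%N | exact: nsim |].
  move=> _ [a [a0 [b [s [hs ->]]]]].
  have [a1|a2] : a = 1 \/ a = 2%:R.
    by case: a a0 => [[|[|[|]]] // ?] _; [left | right]; apply/val_inj.
  - by left; subst a; apply: rho2_rsim.
  by right; subst a; apply: rho2_rsim.
exact: rho2_rsim.
Qed.
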